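(* For any diagonal section $\delta$ the following are equivalent: (i) $\overline{C}_\delta=K_\delta$; (ii) $\delta'(x)\in\{0,2\}$ for almost every $x$ in the set $\Lambda=\{x\in[0,1]:\delta(x)<x\}$.
   Context: $\mathbb{I}=[0,1]$. A (bivariate) copula is a function $C\colon\mathbb{I}^2\to\mathbb{I}$ with $C(x,0)=C(0,y)=0$, $C(x,1)=x$, $C(1,y)=y$ for all $x,y$, and $C(b,d)+C(a,c)-C(b,c)-C(a,d)\ge 0$ for all $a\le b$, $c\le d$. A diagonal section is a function $\delta\colon\mathbb{I}\to\mathbb{I}$ with $\delta(x)\le x$ for all $x$, $0\le\delta(y)-\delta(x)\le 2(y-x)$ whenever $x\le y$, and $\delta(1)=1$ (such $\delta$ is Lipschitz, hence differentiable a.e.). Define $\overline{C}_\delta(x,y)=\sup\{C(x,y): C \text{ a copula with } C(t,t)=\delta(t)\ \forall t\}$ and $K_\delta(x,y)=\sup\{C(x,y): C \text{ a copula with } C(x,y)=C(y,x) \text{ for all } x,y \text{ and } C(t,t)=\delta(t)\ \forall t\}$. *)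

(* Defs.v *)
From HB Require Import structures.
From mathcomp Require Import all_boot all_order all_algebra.
From mathcomp Require Import all_classical all_reals all_analysis.
Set Implicit Arguments. Unset Strict Implicit. Unset Printing Implicit Defensive.
Import Order.TTheory GRing.Theory Num.Theory.
Import numFieldNormedType.Exports.
Local Open Scope classical_set_scope.
Local Open Scope ring_scope.

(* Functions on I = [0,1] are represented as total functions R -> R;
   only their values on [0,1] are constrained / used. *)
Definition inI {R : realType} (x : R) : Prop := 0 <= x /\ x <= 1.

Definition is_copula {R : realType} (C : R -> R -> R) : Prop :=
  (forall x y, inI x -> inI y -> inI (C x y)) /\
  (forall x, inI x -> C x 0 = 0 /\ C 0 x = 0 /\ C x 1 = x /\ C 1 x = x) /\
  (forall a b c d, inI a -> inI b -> inI c -> inI d -> a <= b -> c <= d ->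
     0 <= C b d + C a c - C b c - C a d).

Definition is_diagonal {R : realType} (delta : R -> R) : Prop :=
  (forall x, inI x -> inI (delta x)) /\
  (forall x, inI x -> delta x <= x) /\
  (forall x y, inI x -> inI y -> x <= y ->
     0 <= delta y - delta x /\ delta y - delta x <= 2 * (y - x)) /\
  delta 1 = 1.

Definition copulas_with_diag {R : realType} (delta : R -> R) :
  set (R -> R -> R) :=
  [set C | is_copula C /\ forall t, inI t -> C t t = delta t].

Definition sym_copulas_with_diag {R : realType} (delta : R -> R) :
  set (R -> R -> R) :=
  [set C | copulas_with_diag delta C /\
           forall x y, inI x -> inI y -> C x y = C y x].

Definition Cbar {R : realType} (delta : R -> R) (x y : R) : R :=
  sup [set C x y | C in copulas_with_diag delta].

Definition Kdelta {R : realType} (delta : R -> R) (x y : R) : R :=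
  sup [set C x y | C in sym_copulas_with_diag delta].

Definition Lambda {R : realType} (delta : R -> R) : set R :=
  [set x | inI x /\ delta x < x].

(* Main.v *)
(** For densities [a, b] in [0, 1] with [a + b = delta'], primitives [A, B] give the
   copula [min (x, y, A x + B y)] with diagonal [delta]; the choice [a = b] gives
   [K_delta = min (x, y, (delta x + delta y) / 2)].  If [0 < delta' < 2] on a set
   of positive measure in [Lambda], an unequal splitting exceeds [K_delta].
   Conversely every copula satisfies, for [x <= y] with no fixed point of [delta]
   in between, [C x y <= delta x + \int_x^y min 1 delta'], and the right-hand
   side is [(delta x + delta y) / 2] when [delta'] is 0 or 2; a fixed point in
   [[x, y]] makes [x <= (delta x + delta y) / 2]. *)

Require Import Defs.
From HB Require Import structures.
From mathcomp Require Import all_boot all_order all_algebra.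
From mathcomp Require Import all_classical all_reals all_analysis.
From mathcomp Require Import measurable_realfun lra.
Import Order.TTheory GRing.Theory Num.Theory.
Import numFieldNormedType.Exports.
Local Open Scope classical_set_scope.
Local Open Scope ring_scope.

(** * Nonexpansive functions and the sign of a derivative at a point *)

Lemma nonexpansive_continuous {R : realType} (F : R -> R) :
  (forall x y, x <= y -> 0 <= F y - F x <= y - x) -> continuous F.
Proof.
move=> FL x; apply/cvgrPdist_le => e e0; near=> y.
have xy : `|x - y| <= e by near: y; exact: cvgr_dist_le.
apply: le_trans xy.
have [xy|/ltW yx] := leP x y.
  have /andP[? ?] := FL _ _ xy.
  by rewrite ler0_norm ?ler0_norm ?subr_le0//; lra.
have /andP[? ?] := FL _ _ yx.
by rewrite ger0_norm ?ger0_norm ?subr_ge0//; lra.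
Unshelve. all: by end_near. Qed.

(** The difference quotient at [t] is the product in the hypothesis divided by the square of the
    increment, so both sides of [t] are treated at once. *)
Lemma derive1_ge0_near {R : realType} (g : R -> R) t : derivable g t 1 ->
  (\forall s \near t, 0 <= (s - t) * (g s - g t)) -> 0 <= derive1 g t.
Proof.
move=> dg gt; rewrite derive1E /derive.
have ht : \forall h \near (0 : R), 0 <= h * (g (h + t) - g t).
  have ct : (h + t) @[h --> (0 : R)] --> t.
    by rewrite -{2}[t]add0r; apply: cvgD; [exact: cvg_id|exact: cvg_cst].
  have H := ct _ gt; near=> h; have : 0 <= (h + t - t) * (g (h + t) - g t).
    by near: h; exact: H.
  by rewrite addrK.
apply: limr_ge => //; near=> h.
rewrite /GRing.scale/= mulr1.
have -> : h^-1 * (g (h + t) - g t) = (h ^- 2) * (h * (g (h + t) - g t)).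
  by rewrite -exprVn expr2 -mulrA mulKf//; near: h; exact: nbhs_dnbhs_neq.
by rewrite mulr_ge0 ?invr_ge0 ?sqr_ge0//; near: h; exact: nbhs_dnbhs.
Unshelve. all: by end_near. Qed.

(** * The Stieltjes measure of a nonexpansive function and its density *)

Section stieltjes.
Context {R : realType}.
Variable F : R -> R.
Hypothesis FL : forall x y, x <= y -> 0 <= F y - F x <= y - x.

Let F_nd : {homo F : x y / x <= y}.
Proof. by move=> x y /FL /andP[+ _]; rewrite subr_ge0. Qed.

Let F_rc : right_continuous F.
Proof. by apply/right_continuousW/nonexpansive_continuous. Qed.

Definition stieltjes_cumulative : cumulative R R :=
  HB.pack_for (cumulative R R) F (isCumulative.Build R _ R F F_nd F_rc).

Lemma stieltjes_itv a b : a <= b ->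
  lebesgue_stieltjes_measure stieltjes_cumulative `]a, b] = (F b - F a)%:E.
Proof.
move=> ab; rewrite /lebesgue_stieltjes_measure.
rewrite /measure_extension measurable_mu_extE/=; last exact: is_ocitv.
by rewrite wlength_itv_bnd.
Qed.

End stieltjes.

Section density.
Context {R : realType}.
Variable F : R -> R.
Hypothesis FL : forall x y, x <= y -> 0 <= F y - F x <= y - x.
Let mu := @lebesgue_measure R.

(* With [G = id - F], the measures of [F] and [G] add up to Lebesgue measure. *)
Lemma stieltjes_le_lebesgue (A : set (measurableTypeR R)) : measurable A ->
  (lebesgue_stieltjes_measure (stieltjes_cumulative F FL) A <= mu A)%E.
Proof.
have GL x y : x <= y -> 0 <= (y - F y) - (x - F x) <= y - x.
  by move=> /FL; lra.
pose m := measure_add (lebesgue_stieltjes_measure (stieltjes_cumulative F FL))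
   (lebesgue_stieltjes_measure (stieltjes_cumulative _ GL)).
have mE X : m X = (lebesgue_stieltjes_measure (stieltjes_cumulative F FL) X +
   lebesgue_stieltjes_measure (stieltjes_cumulative _ GL) X)%E.
  exact: measure_addE.
move=> mA; rewrite /mu (@lebesgue_measure_unique _ m)//.
  by rewrite [leRHS]mE leeDl.
move=> X [[a b] _ <-] /=.
rewrite [RHS]mE.
have [ab|/ltW ba] := leP a b; last first.
  by rewrite set_itv_ge ?measure0 ?adde0 ?bnd_simp -?leNgt.
rewrite !stieltjes_itv// lebesgue_measure_itv /= lte_fin.
move: ab; rewrite le_eqVlt => /predU1P[->|->].
  by rewrite ltxx !subrr adde0.
by rewrite -EFinB -EFinD; congr EFin; lra.
Qed.

(** Both [F] and [id - F] are nondecreasing, so both have a nonnegative derivative. *)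
Lemma nonexpansive_derive1_itv x : derivable F x 1 -> 0 <= derive1 F x <= 1.
Proof.
move=> dF; apply/andP; split.
  apply: derive1_ge0_near => //; near=> s.
  have [/[dup] xs /FL|/ltW/[dup] sx /FL] := leP x s; first nra.
  nra.
have did := @derivable_id R R x 1.
rewrite -subr_ge0 (_ : 1 - derive1 F x = derive1 (id - F) x); last first.
  by rewrite !derive1E (deriveB did dF) derive_id.
apply: derive1_ge0_near; first exact: derivableB did dF.
near=> s; rewrite !fctE.
have [/[dup] xs /FL|/ltW/[dup] sx /FL] := leP x s; first nra.
nra.
Unshelve. all: by end_near. Qed.

(* [radon_nikodym_sigma_finite] yields the density [f0]; it may exceed 1 on a
   null set, hence the truncation. *)
Lemma nonexpansive_density (a b : R) : a <= b -> exists f : R -> R,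
  [/\ forall x, 0 <= f x <= 1,
      mu.-integrable setT (EFin \o f),
      forall x, a <= x <= b -> F x - F a = \int[mu]_(t in `[a, x]) f t &
      {ae mu, forall x, a < x < b -> derivable F x 1 /\ derive1 F x = f x}].
Proof.
move=> ab.
pose nuF := lebesgue_stieltjes_measure (stieltjes_cumulative F FL).
have mI : measurable (`]a, b]%classic : set (measurableTypeR R)).
  exact: measurable_itv.
have nuI : (nuF `]a, b]%classic < +oo)%E by rewrite /nuF stieltjes_itv// ltry.
(* Restriction to []a, b]] makes the measure finite, so that the Radon-Nikodym theorem applies. *)
pose nu := mfrestr mI nuI.
have numu : nu `<< mu.
  apply/null_content_dominatesP => A mA A0.
  apply/eqP; rewrite eq_le measure_ge0 andbT -A0.
  apply: le_trans (stieltjes_le_lebesgue A mA).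
  by rewrite /nu /mfrestr /mrestr le_measure// inE//; exact: measurableI.
have [g [g0 gfin gint gE]] := radon_nikodym_sigma_finite numu.
pose f0 := fine \o g.
have f0E : EFin \o f0 = g by apply/funext => x; rewrite /f0/= fineK.
have if0 : mu.-integrable setT (EFin \o f0) by rewrite f0E.
have FE x : a <= x <= b -> F x - F a = \int[mu]_(t in `[a, x]) f0 t.
  move=> /andP[ax xb].
  rewrite -Rintegral_itv_obnd_cbnd; last exact: integrableS if0.
  rewrite /Rintegral.
  have -> : (\int[mu]_(t in `]a, x]) (f0 t)%:E = \int[mu]_(t in `]a, x]) g t)%E.
    by apply: eq_integral => t _; rewrite -[LHS]/((EFin \o f0) t) f0E.
  rewrite -gE//= /mfrestr /mrestr setIidl; last exact: subset_itvl.
  by rewrite /nuF stieltjes_itv.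
have F'E : {ae mu, forall x, a < x < b ->
    derivable F x 1 /\ derive1 F x = f0 x}.
  have /FTC1 : forall y,
      mu.-integrable [set` Interval (BLeft a) (BRight y)] (EFin \o f0).
    by move=> y; exact: integrableS if0.
  have lf0 : locally_integrable [set: R] f0.
    have := integrable_locally measurableT if0.
    by rewrite patch_setT.
  move=> /(_ lf0); apply: filterS; first exact: (ae_filter_ringOfSetsType mu).
  move=> x /= + /andP[ax xb].
  rewrite lte_fin => /(_ ax) [dI I'E].
  have IF : \forall y \near x,
      F a + \int[mu]_(t in `[a, y]) f0 t = F y.
    near=> y; rewrite -FE ?subrKC//.
    apply/andP; split.
      by near: y; exact: lt_le_nbhsr.
    by near: y; exact: lt_le_nbhsl.
  split.
    by apply: near_eq_derivable IF _; exact: derivableD (derivable_cst _ _ _) dI.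
  rewrite derive1E -(near_eq_derive _ IF).
  by rewrite (deriveD (derivable_cst _ _ _) dI) derive_cst add0r -derive1E.
pose f x := Num.min (f0 x) 1.
have f01 x : 0 <= f x <= 1.
  by rewrite /f le_min ge_min lexx orbT !andbT ler01 andbT /f0 fine_ge0.
have iff : mu.-integrable setT (EFin \o f).
  apply: le_integrable (if0) => //.
    apply/measurable_EFinP/measurable_minr => //.
    by case/integrableP: (if0) => /measurable_EFinP.
  move=> x _ /=; rewrite lee_fin.
  have /andP[fx0 _] := f01 x.
  have ff0 : f x <= f0 x by rewrite /f ge_min lexx.
  by rewrite !ger0_norm// (le_trans fx0).
(* Almost everywhere in []a, b[] the density is a derivative of [F], hence at most 1, and truncation
   leaves it unchanged. *)
have fE : {ae mu, forall x, a < x < b -> f0 x = f x}.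
  move: (F'E); apply: filterS; first exact: (ae_filter_ringOfSetsType mu).
  move=> x /= + axb => /(_ axb)[dF F'x].
  have := nonexpansive_derive1_itv x dF.
  by rewrite F'x /f => /andP[_ ?]; rewrite min_l.
exists f; split => //.
- move=> x axb; rewrite FE//; case/andP: axb => ax xb.
  (* Both endpoints are dropped, since [f0] and [f] are compared only inside []a, b[]. *)
  rewrite -!Rintegral_itv_obnd_cbnd;
    [|exact: integrableS iff|exact: integrableS if0].
  rewrite -!Rintegral_itv_bndo_bndc;
    [|exact: integrableS iff|exact: integrableS if0].
  rewrite /Rintegral; congr fine; apply: ae_eq_integral => //.
  + apply: measurable_funTS; exact: measurable_int if0.
  + apply: measurable_funTS; exact: measurable_int iff.
  + move: fE; apply: filterS; first exact: (ae_filter_ringOfSetsType mu).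
    move=> t /= + /=; rewrite in_itv/= => + /andP[at_ tx].
    by move=> ->//; rewrite at_/= (lt_le_trans tx).
- move: F'E fE; apply: filterS2; first exact: (ae_filter_ringOfSetsType mu).
  move=> x /= h1 h2 axb.
  by have [? ->] := h1 axb; rewrite h2.
Unshelve. all: by end_near. Qed.

End density.

(** Clamping the argument to [0, 1] extends [F] to a nonexpansive function on the line and changes
    nothing near an interior point. *)
Lemma unit_lip_density {R : realType} (F : R -> R) :
  (forall x y, inI x -> inI y -> x <= y -> 0 <= F y - F x <= y - x) ->
  exists f : R -> R,
  [/\ forall x, 0 <= f x <= 1,
      lebesgue_measure.-integrable setT (EFin \o f),
      forall x, inI x -> F x - F 0 = \int[lebesgue_measure]_(t in `[0, x]) f t &
      {ae lebesgue_measure, forall x : R, 0 < x < 1 ->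
         derivable F x 1 /\ derive1 F x = f x}].
Proof.
move=> FL.
pose c (t : R) := Num.max 0 (Num.min 1 t).
have cE t : inI t -> c t = t by move=> [? ?]; rewrite /c min_r ?max_r.
have cL x y : x <= y -> [/\ inI (c x), inI (c y) & 0 <= c y - c x <= y - x].
  rewrite /c /inI => xy; case: (leP 1 x) => ?; case: (leP 1 y) => ?;
    rewrite ?(max_r ler01); case: (leP 0 x) => ?; case: (leP 0 y) => ?;
    split; lra.
have FcL x y : x <= y -> 0 <= F (c y) - F (c x) <= y - x.
  by move=> /cL[Ix Iy ?]; have := FL _ _ Ix Iy; lra.
have [f [f01 fint fE F'E]] := nonexpansive_density (F \o c) FcL 0 1 ler01.
exists f; split => //.
  move=> x Ix; rewrite -fE; last exact/andP.
  by rewrite /= !cE//; exact: inI0.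
move: F'E; apply: filterS; first exact: (ae_filter_ringOfSetsType lebesgue_measure).
move=> x /= + x01 => /(_ x01)[dF <-].
have Fc : \forall y \near x, (F \o c) y = F y.
  near=> y; rewrite /= cE//; split.
    by near: y; apply: lt_le_nbhsr; case/andP: x01.
  by near: y; apply: lt_le_nbhsl; case/andP: x01.
split; first exact: near_eq_derivable dF.
by rewrite !derive1E (near_eq_derive _ Fc).
Unshelve. all: by end_near. Qed.

(** Provides the growth bounds that [split_copula_diag] asks of the primitives [A] and [B]. *)
Lemma Rintegral_lip {R : realType} (h : R -> R) :
  (forall x, 0 <= h x <= 1) ->
  lebesgue_measure.-integrable setT (EFin \o h) ->
  let H x := \int[lebesgue_measure]_(t in `[0, x]) h t in
  forall x y, inI x -> inI y -> x <= y -> 0 <= H y - H x <= y - x.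
Proof.
move=> h01 ih H x y Ix Iy xy.
rewrite /H Rintegral_itvB ?bnd_simp//; [|exact: integrableS ih|exact: Ix.1].
apply/andP; split.
  by apply: Rintegral_ge0 => t _; case/andP: (h01 t).
have -> : y - x = fine (lebesgue_measure (`]x, y]%classic : set R)).
  rewrite lebesgue_measure_itv/= lte_fin.
  by case: ltgtP xy => // -> _; rewrite subrr.
rewrite -[leRHS]mul1r -Rintegral_cst//.
apply: le_Rintegral => //.
- exact: integrableS ih.
- apply/integrableP; split; first exact/measurable_EFinP.
  under eq_integral do rewrite /= normr1.
  rewrite integral_cst// mul1e.
  by rewrite [ltLHS]lebesgue_measure_itv/=; case: ifP; rewrite ltry.
- by move=> t _; case/andP: (h01 t).
Qed.

(** * Copulas obtained by splitting the diagonal *)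

Lemma min_supermodular {R : realDomainType} (p1 p2 q1 q2 : R) :
  p1 <= p2 -> q1 <= q2 ->
  0 <= Num.min p2 q2 + Num.min p1 q1 - Num.min p2 q1 - Num.min p1 q2.
Proof.
by move=> ? ?; case: (leP p2 q2) => ?; case: (leP p1 q1) => ?;
   case: (leP p2 q1) => ?; case: (leP p1 q2) => ?; lra.
Qed.

Lemma inI0 {R : realType} : @inI R 0. Proof. by split; lra. Qed.
Lemma inI1 {R : realType} : @inI R 1. Proof. by split; lra. Qed.

(* A rectangle is cut by the diagonal into a diagonal square and rectangles
   lying on one side of the diagonal. *)
Lemma two_increasing_cut {R : realType} (C : R -> R -> R) :
  (forall a b c d, inI a -> inI d -> a <= b -> b <= c -> c <= d ->
     0 <= C b d + C a c - C b c - C a d) ->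
  (forall a b c d, inI b -> inI c -> c <= d -> d <= a -> a <= b ->
     0 <= C b d + C a c - C b c - C a d) ->
  (forall a b, inI a -> inI b -> a <= b ->
     0 <= C b b + C a a - C b a - C a b) ->
  forall a b c d, inI a -> inI b -> inI c -> inI d -> a <= b -> c <= d ->
     0 <= C b d + C a c - C b c - C a d.
Proof.
move=> above below square a b c d Ia Ib Ic Id ab cd.
have [bc|/ltW cb] := leP b c; first exact: above.
have [da|/ltW ad] := leP d a; first exact: below.
(* The intervals now overlap, and the diagonal square is the one over their intersection; the four
   cases say which endpoints bound it. *)
have [ac|/ltW ca] := leP a c; have [bd|/ltW db] := leP b d.
- have := above a c c b Ia Ib ac (lexx _) cb.
  have := above a c b d Ia Id ac cb bd.
  have := square c b Ic Ib cb.
  have := above c b b d Ic Id cb (lexx _) bd.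
  lra.
- have := above a c c d Ia Id ac (lexx _) cd.
  have := square c d Ic Id cd.
  have := below d b c d Ib Ic cd (lexx _) db.
  lra.
- have := below a b c a Ib Ic ca (lexx _) ab.
  have := square a b Ia Ib ab.
  have := above a b b d Ia Id ab (lexx _) bd.
  lra.
- have := below a d c a Id Ic ca (lexx _) ad.
  have := square a d Ia Id ad.
  have := below d b c a Ib Ic ca ad db.
  have := below d b a d Ib Ia ad (lexx _) db.
  lra.
Qed.

(* [A x + B y] is modular, so [min (A x + B y) z] is 2-increasing when [z] is [x]
   (resp. [y]): factor out [A x] (resp. [B y]).  For [A = B = delta / 2] this is
   the largest symmetric copula with diagonal [delta]. *)
Definition split_copula {R : realType} (A B : R -> R) (x y : R) : R :=
  Num.min (Num.min x y) (A x + B y).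

Lemma split_copula_diag {R : realType} (delta A B : R -> R) :
  is_diagonal delta ->
  (forall t, inI t -> A t + B t = delta t) -> A 0 = 0 -> B 0 = 0 ->
  (forall x y, inI x -> inI y -> x <= y -> 0 <= A y - A x <= y - x) ->
  (forall x y, inI x -> inI y -> x <= y -> 0 <= B y - B x <= y - x) ->
  copulas_with_diag delta (split_copula A B).
Proof.
move=> [_ [dle [_ d1]]] AB A0 B0 Alip Blip.
have Cdiag t : inI t -> split_copula A B t t = delta t.
  by move=> It; rewrite /split_copula minxx AB// min_r ?dle.
(* As [A] is nonexpansive, [x - A x] is nondecreasing, so [min_supermodular] handles the second
   summand. *)
have C_above x y : x <= y -> split_copula A B x y = A x + Num.min (x - A x) (B y).
  by move=> xy; rewrite /split_copula (min_l xy) addr_minr subrKC.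
have C_below x y : y <= x -> split_copula A B x y = B y + Num.min (y - B y) (A x).
  by move=> xy; rewrite /split_copula (min_r xy) addr_minr subrKC (addrC (A x)).
split=> //; split; [|split].
- move=> x y Ix Iy; split.
    have := Alip _ _ inI0 Ix Ix.1; have := Blip _ _ inI0 Iy Iy.1.
    rewrite A0 B0 !le_min Ix.1 Iy.1/=; lra.
  by rewrite /split_copula !ge_min Ix.2.
- move=> x Ix; have := Alip _ _ inI0 Ix Ix.1; have := Blip _ _ inI0 Ix Ix.1.
  have := Alip _ _ Ix inI1 Ix.2; have := Blip _ _ Ix inI1 Ix.2.
  have := AB _ inI1; case: (Ix) => ? ?.
  rewrite A0 B0 d1 /split_copula => ? ? ? ? ?; split; [|split; [|split]].
  + by rewrite (min_r (_ : 0 <= x))// B0 min_l//; lra.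
  + by rewrite (min_l (_ : 0 <= x))// A0 min_l//; lra.
  (* From [A 1 + B 1 = 1] and [A 1 - A x <= 1 - x] follows [x <= A x + B 1]; the last case exchanges
     [A] and [B]. *)
  + by rewrite (min_l (_ : x <= 1))// min_l//; lra.
  + by rewrite (min_r (_ : x <= 1))// min_l//; lra.
apply: two_increasing_cut.
- move=> a b c d Ia Id ab bc cd.
  have Ib : inI b by move: Ia Id; rewrite /inI; lra.
  have Ic : inI c by move: Ia Id; rewrite /inI; lra.
  rewrite !C_above; try lra.
  have := @min_supermodular R (a - A a) (b - A b) (B c) (B d).
  by have := Alip _ _ Ia Ib ab; have := Blip _ _ Ic Id cd; lra.
- move=> a b c d Ib Ic cd da ab.
  have Ia : inI a by move: Ib Ic; rewrite /inI; lra.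
  have Id : inI d by move: Ib Ic; rewrite /inI; lra.
  rewrite !C_below; try lra.
  have := @min_supermodular R (c - B c) (d - B d) (A a) (A b).
  by have := Alip _ _ Ia Ib ab; have := Blip _ _ Ic Id cd; lra.
(* The modular sum [A x + B y] is attained on the diagonal and is an upper bound off it. *)
- move=> a b Ia Ib ab; rewrite !Cdiag// -!AB//.
  have Cle x y : split_copula A B x y <= A x + B y.
    by rewrite /split_copula ge_min lexx orbT.
  by have := Cle a b; have := Cle b a; lra.
Qed.

(** * Pointwise bounds and the largest symmetric copula *)

Lemma copula_le_min {R : realType} (C : R -> R -> R) x y :
  is_copula C -> inI x -> inI y -> C x y <= Num.min x y.
Proof.
move=> [_ [Cb C2]] Ix Iy; rewrite le_min; apply/andP; split.
  (* The rectangles are [0, x] x [y, 1] here and [x, 1] x [0, y] for the other bound. *)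
  have := C2 _ _ _ _ inI0 Ix Iy inI1 Ix.1 Iy.2.
  by have := Cb _ Ix; have := Cb _ Iy; have := Cb _ inI1; lra.
have := C2 _ _ _ _ Ix inI1 inI0 Iy Ix.2 Iy.1.
by have := Cb _ Ix; have := Cb _ Iy; have := Cb _ inI1; lra.
Qed.

Lemma sup_attained {R : realType} (E : set R) m : E m -> ubound E m -> sup E = m.
Proof.
move=> Em Eub; apply/eqP; rewrite eq_le; apply/andP; split.
  by apply: ge_sup => //; exists m.
by apply: ub_le_sup => //; exists m.
Qed.

Lemma half_diagonal_lip {R : realType} (delta : R -> R) : is_diagonal delta ->
  forall x y, inI x -> inI y -> x <= y -> 0 <= delta y / 2 - delta x / 2 <= y - x.
Proof. by move=> [_ [_ [dL _]]] x y Ix Iy xy; have := dL _ _ Ix Iy xy; lra. Qed.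

Lemma diagonal0 {R : realType} (delta : R -> R) : is_diagonal delta -> delta 0 = 0.
Proof.
move=> [dI [dle _]]; have := dle _ inI0; have [? _] := dI _ inI0.
by move=> ?; apply/eqP; rewrite eq_le; apply/andP.
Qed.

Lemma half_split_sym_copula {R : realType} (delta : R -> R) : is_diagonal delta ->
  sym_copulas_with_diag delta
    (split_copula (fun t => delta t / 2) (fun t => delta t / 2)).
Proof.
move=> dd; split.
  have d0 := diagonal0 _ dd; have dL := half_diagonal_lip _ dd.
  by apply: split_copula_diag => //; rewrite ?d0 ?mul0r// => t _; lra.
by move=> x y _ _; rewrite /split_copula (minC x) addrC.
Qed.

(** By symmetry the inequality on the square over the interval between [x] and [y] reads
    [2 * C x y <= delta x + delta y]; the half splitting attains the resulting bound. *)
Lemma KdeltaE {R : realType} (delta : R -> R) x y :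
  is_diagonal delta -> inI x -> inI y ->
  Kdelta delta x y = Num.min (Num.min x y) ((delta x + delta y) / 2).
Proof.
move=> dd Ix Iy; rewrite mulrDl; apply: sup_attained.
  by exists (split_copula (fun t => delta t / 2) (fun t => delta t / 2));
    [exact: half_split_sym_copula|].
move=> _ [C [[Ccop Cd] Csym] <-]; rewrite le_min copula_le_min//=.
have [_ [_ C2]] := Ccop.
have [xy|/ltW xy] := leP x y.
  have := C2 _ _ _ _ Ix Iy Ix Iy xy xy.
  by rewrite !Cd// (Csym y x)//; lra.
have := C2 _ _ _ _ Iy Ix Iy Ix xy xy.
by rewrite !Cd// (Csym y x)//; lra.
Qed.

Lemma le_Cbar {R : realType} (delta : R -> R) C x y :
  inI x -> inI y -> copulas_with_diag delta C -> C x y <= Cbar delta x y.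
Proof.
move=> Ix Iy Cd; apply: ub_le_sup; last by exists C.
by exists (Num.min x y) => _ [D [Dcop _] <-]; exact: copula_le_min.
Qed.

(** * Upper bound for all copulas when the derivative of the diagonal is 0 or 2 *)

Lemma derive1_half {R : realType} (g : R -> R) t : derivable g t 1 ->
  derivable (fun s => g s / 2) t 1 /\
  derive1 (fun s => g s / 2) t = derive1 g t / 2.
Proof.
move=> dg; have -> : (fun s => g s / 2) = 2^-1 \*: g.
  by apply/funext => s; rewrite mulrC.
split; first exact: derivableZ.
by rewrite !derive1E deriveZ//= mulrC.
Qed.

Lemma derive1_half_inv {R : realType} (g : R -> R) t :
  derivable (fun s => g s / 2) t 1 ->
  derivable g t 1 /\ derive1 g t = 2 * derive1 (fun s => g s / 2) t.
Proof.
move=> dg; have gE : g = 2 \*: (fun s => g s / 2).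
  by apply/funext => s /=; rewrite /GRing.scale/=; lra.
rewrite [in derivable g](gE) [in LHS]gE; split; first exact: derivableZ.
by rewrite !derive1E deriveZ.
Qed.

(** Use the rectangles [0, x] x [s, t] and [x, 1] x [s, t]. *)
Lemma copula_section_lip {R : realType} (C : R -> R -> R) x :
  is_copula C -> inI x ->
  forall s t, inI s -> inI t -> s <= t -> 0 <= C x t - C x s <= t - s.
Proof.
move=> [_ [Cb C2]] Ix s t Is It st; apply/andP; split.
  have := C2 _ _ _ _ inI0 Ix Is It Ix.1 st.
  by have := Cb _ Is; have := Cb _ It; lra.
have := C2 _ _ _ _ Ix inI1 Is It Ix.2 st.
by have := Cb _ Is; have := Cb _ It; lra.
Qed.

(** The rectangle [x, t] x [s, t] bounds the increment of [C x] by [C t t - C t s], and [s, t] x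
    [0, s] gives [C s s <= C t s]. *)
Lemma diagonal_sub_section_nondecreasing {R : realType} (delta : R -> R) C x s t :
  copulas_with_diag delta C -> inI x -> inI t -> x <= s -> s <= t ->
  delta s - C x s <= delta t - C x t.
Proof.
move=> [Ccop Cd] Ix It xs st.
have Is : inI s by move: Ix It; rewrite /inI; lra.
have [_ [_ C2]] := Ccop.
have := C2 _ _ _ _ Ix It Is It (le_trans xs st) st.
have := copula_section_lip _ _ Ccop Is _ _ Is It st.
have := C2 _ _ _ _ Ix Is Is It xs st.
have := C2 _ _ _ _ Is It inI0 Is st Is.1.
have [_ [Cb _]] := Ccop.
have := Cb _ Is; have := Cb _ It.
rewrite -!Cd//; lra.
Qed.

(* For [t >= x] the section [C x] grows at most as fast as both [t] and [delta],
   so its derivative is at most [min 1 delta'], which is [delta' / 2] when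
   [delta'] is 0 or 2. *)
Lemma copula_le_half_diag {R : realType} (delta : R -> R) C x y :
  is_diagonal delta ->
  {ae lebesgue_measure, forall t : R, Lambda delta t ->
     derivable delta t 1 /\ (derive1 delta t = 0 \/ derive1 delta t = 2)} ->
  copulas_with_diag delta C -> inI x -> inI y -> x <= y ->
  (forall t, x <= t <= y -> delta t < t) ->
  C x y <= (delta x + delta y) / 2.
Proof.
move=> dd Lae Cd Ix Iy xy dlt.
have [p [p01 pint pE p'E]] := unit_lip_density _ (copula_section_lip _ _ Cd.1 Ix).
have [f [f01 fint fE f'E]] := unit_lip_density _ (half_diagonal_lip _ dd).
pose mu := @lebesgue_measure R.
have incr (F h : R -> R) : mu.-integrable setT (EFin \o h) ->
    (forall x, inI x -> F x - F 0 = \int[mu]_(t in `[0, x]) h t) ->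
    F y - F x = \int[mu]_(t in `]x, y[) h t.
  move=> ih FE; rewrite Rintegral_itv_bndo_bndc; last exact: integrableS ih.
  rewrite -(@Rintegral_itvB _ _ (BLeft 0)) ?bnd_simp//; last 2 first.
    exact: integrableS ih.
    exact: Ix.1.
  by rewrite -!FE//; lra.
have pf : {ae mu, forall t, t \in `]x, y[ -> p t <= f t}.
  move: Lae p'E f'E; apply: filterS3; first exact: (ae_filter_ringOfSetsType mu).
  move=> t /= hL hp hf; rewrite in_itv/= => /andP[xt ty].
  have t01 : 0 < t < 1.
    by rewrite (le_lt_trans Ix.1 xt)/= (lt_le_trans ty)//; exact: Iy.2.
  have It : inI t by split; case/andP: t01 => *; exact: ltW.
  have Lt : Lambda delta t by split => //; apply: dlt; rewrite !ltW.
  have [dp pt] := hp t01; have [_ ft] := hf t01.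
  have [dd' d02] := hL Lt.
  have [_ half] := derive1_half _ _ dd'.
  (* If [delta'] is 2 then [f t = 1] bounds [p t]; if it is 0, comparison with [delta] gives
     [p t <= 0]. *)
  case: d02 => d02; last first.
    by rewrite -ft half d02; have := p01 t; lra.
  suff : 0 <= derive1 (delta - C x) t.
    by rewrite derive1E deriveB// -!derive1E d02 pt; have := f01 t; lra.
  apply: derive1_ge0_near; first exact: derivableB.
  near=> s; rewrite !fctE.
  have xs : x <= s by near: s; apply: lt_le_nbhsr.
  have sy : s <= y by near: s; apply: lt_le_nbhsl.
  have Is : inI s by move: Ix Iy; rewrite /inI; lra.
  have [ts|/ltW st] := leP t s.
    have := diagonal_sub_section_nondecreasing delta C x t s Cd Ix Is (ltW xt) ts.
    by move=> ?; apply: mulr_ge0; lra.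
  have := diagonal_sub_section_nondecreasing delta C x s t Cd Ix It xs st.
  by move=> ?; apply: mulr_le0; lra.
suff : C x y - C x x <= delta y / 2 - delta x / 2.
  by rewrite Cd.2//; lra.
rewrite (incr _ _ pint pE) (incr (fun t => delta t / 2) _ fint fE).
have fin_int (h : R -> R) : mu.-integrable setT (EFin \o h) ->
    (\int[mu]_(t in `]x, y[) (h t)%:E)%E \is a fin_num.
  by move=> ih; apply: integrable_fin_num => //; exact: integrableS ih.
rewrite /Rintegral; apply: fine_le; [exact: fin_int|exact: fin_int|].
apply: ae_ge0_le_integral => //.
- by move=> t _; rewrite lee_fin; case/andP: (p01 t).
- by apply: measurable_funTS; exact: measurable_int pint.
- by move=> t _; rewrite lee_fin; case/andP: (f01 t).
- by apply: measurable_funTS; exact: measurable_int fint.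
Unshelve. all: by end_near. Qed.

Lemma copula_transpose {R : realType} (delta : R -> R) C :
  copulas_with_diag delta C -> copulas_with_diag delta (fun x y => C y x).
Proof.
move=> [[CI [Cb C2]] Cd]; split=> //; split; [|split].
- by move=> x y Ix Iy; exact: CI.
- by move=> x /Cb [? [? [? ?]]].
- move=> a b c d Ia Ib Ic Id ab cd.
  by have := C2 _ _ _ _ Ic Id Ia Ib cd ab; lra.
Qed.

Lemma copula_le_K {R : realType} (delta : R -> R) C x y :
  is_diagonal delta ->
  {ae lebesgue_measure, forall t : R, Lambda delta t ->
     derivable delta t 1 /\ (derive1 delta t = 0 \/ derive1 delta t = 2)} ->
  copulas_with_diag delta C -> inI x -> inI y ->
  C x y <= Num.min (Num.min x y) ((delta x + delta y) / 2).
Proof.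
move=> dd Lae.
wlog xy : C x y / x <= y.
  move=> H Cd Ix Iy; have [xy|yx] := orP (le_total x y); first exact: H.
  rewrite (minC x) [delta x + _]addrC.
  exact: (H (fun x y => C y x) _ _ yx (copula_transpose _ _ Cd)).
move=> Cd Ix Iy; rewrite le_min copula_le_min//=; last exact: Cd.1.
have [dlt|/existsNP[t /not_implyP[/andP[xt ty]] /negP]] :=
    pselect (forall t, x <= t <= y -> delta t < t).
  exact: (copula_le_half_diag _ _ _ _ dd Lae Cd).
(* At this fixed point [delta x >= t - 2 * (t - x)] and [delta y >= t], so the average is at least
   [x]. *)
rewrite -leNgt => tdt.
have := copula_le_min C x y Cd.1 Ix Iy; rewrite (min_l xy).
have It : inI t by move: Ix Iy; rewrite /inI; lra.
have [_ [_ [dL _]]] := dd.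
by have := dL _ _ Ix It xt; have := dL _ _ It Iy ty; lra.
Qed.

(** * Unequal splittings and the derivative of the diagonal *)

Lemma Cbar_le_split {R : realType} (delta A B : R -> R) x y :
  is_diagonal delta ->
  (forall x y : R, inI x -> inI y -> Cbar delta x y = Kdelta delta x y) ->
  (forall t, inI t -> A t + B t = delta t) -> A 0 = 0 -> B 0 = 0 ->
  (forall x y, inI x -> inI y -> x <= y -> 0 <= A y - A x <= y - x) ->
  (forall x y, inI x -> inI y -> x <= y -> 0 <= B y - B x <= y - x) ->
  inI x -> inI y -> x <= y -> delta y < x -> B y - B x <= A y - A x.
Proof.
move=> dd CK AB A0 B0 AL BL Ix Iy xy dyx.
have := split_copula_diag _ _ _ dd AB A0 B0 AL BL.
move=> /(le_Cbar _ _ _ _ Ix Iy); rewrite CK// KdeltaE//.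
have [_ [_ [dL _]]] := dd; have := dL _ _ Ix Iy xy => dxy.
rewrite /split_copula (min_l xy).
(* Since [(delta x + delta y) / 2 <= delta y < x], the bound is this average, which rules out the
   branch [x] of the splitting copula and leaves [A x + B y]. *)
rewrite [leRHS]min_r; last by lra.
rewrite ge_min => /orP[|]; first by lra.
by have := AB _ Ix; have := AB _ Iy; lra.
Qed.

(* [f] is the density of [delta / 2].  The splitting [A' = f - k],
   [B' = f + k] with [k = min f (1 - f)] keeps both densities in [0, 1], and (i)
   forces [k = 0] almost everywhere on [Lambda]. *)
Lemma diagonal_derive_ae {R : realType} (delta : R -> R) :
  is_diagonal delta ->
  (forall x y : R, inI x -> inI y -> Cbar delta x y = Kdelta delta x y) ->
  {ae lebesgue_measure, forall t : R, Lambda delta t ->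
     derivable delta t 1 /\ (derive1 delta t = 0 \/ derive1 delta t = 2)}.
Proof.
move=> dd CK; pose mu := @lebesgue_measure R.
have [f [f01 fint fE f'E]] := unit_lip_density _ (half_diagonal_lip _ dd).
pose k t := Num.min (f t) (1 - f t).
have k0 t : 0 <= k t by rewrite /k le_min; have := f01 t; lra.
have kf t : k t <= f t by rewrite /k ge_min lexx.
have k1f t : k t <= 1 - f t by rewrite /k ge_min lexx orbT.
have fk01 t : 0 <= f t + k t <= 1.
  by have := f01 t; have := k0 t; have := k1f t; lra.
have fBk01 t : 0 <= f t - k t <= 1.
  by have := f01 t; have := k0 t; have := kf t; lra.
have kint : mu.-integrable setT (EFin \o k).
  have mf : measurable_fun setT f.
    by case/integrableP: (fint) => /measurable_EFinP.
  apply: le_integrable (fint) => //.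
    by apply/measurable_EFinP/measurable_minr => //; exact: measurable_funB.
  by move=> x _ /=; rewrite lee_fin !ger0_norm//; case/andP: (f01 x).
have fkint : mu.-integrable setT (EFin \o (fun t => f t + k t)).
  exact: (integrableD measurableT fint kint).
have fBkint : mu.-integrable setT (EFin \o (fun t => f t - k t)).
  exact: (integrableB measurableT fint kint).
have sub0 (h : R -> R) x : mu.-integrable setT (EFin \o h) ->
    mu.-integrable `[0, x] (EFin \o h) by move=> ih; exact: integrableS ih.
pose B x := \int[mu]_(t in `[0, x]) (f t + k t).
pose A x := \int[mu]_(t in `[0, x]) (f t - k t).
pose H x := \int[mu]_(t in `[0, x]) k t.
have BE x : B x = \int[mu]_(t in `[0, x]) f t + H x.
  by apply: RintegralD => //; exact: sub0.
have AE x : A x = \int[mu]_(t in `[0, x]) f t - H x.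
  by apply: RintegralB => //; exact: sub0.
have H0 : H 0 = 0 by rewrite /H set_itv1 Rintegral_set1.
have f0 : \int[mu]_(t in `[0, 0]) f t = 0 by rewrite set_itv1 Rintegral_set1.
have AL := Rintegral_lip (fun t => f t - k t) fBk01 fBkint.
have BL := Rintegral_lip (fun t => f t + k t) fk01 fkint.
have AB t : inI t -> A t + B t = delta t.
  by move=> It; rewrite AE BE -fE// (diagonal0 _ dd); lra.
(* In [B y - B x <= A y - A x] the integrals of [f] cancel and twice the increment of [H]
   remains. *)
have AB_incr x y : inI x -> inI y -> x <= y -> delta y < x -> H y <= H x.
  move=> Ix Iy xy dyx.
  have := Cbar_le_split delta A B x y dd CK AB.
  rewrite !AE !BE H0 f0 subr0 addr0 => /(_ erefl erefl).
  by move=> /(_ AL BL Ix Iy xy dyx); lra.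
have H'E : {ae mu, forall t : R, 0 < t -> derivable H t 1 /\ derive1 H t = k t}.
  have /FTC1 : forall y,
      mu.-integrable [set` Interval (BLeft 0) (BRight y)] (EFin \o k).
    by move=> y; exact: sub0.
  have lk : locally_integrable [set: R] k.
    have := integrable_locally measurableT kint.
    by rewrite patch_setT.
  move=> /(_ lk); apply: filterS; first exact: (ae_filter_ringOfSetsType mu).
  by move=> x /= + x0; rewrite lte_fin; exact.
move: f'E H'E; apply: filterS2; first exact: (ae_filter_ringOfSetsType mu).
move=> t /= f'E H'E [It dtt].
have [_ [_ [dL d1]]] := dd.
(* The endpoints 0 and 1 are fixed points of [delta], so [Lambda] lies in the open interval. *)
have t0 : 0 < t.
  rewrite lt_neqAle It.1 andbT; apply/negP => /eqP t0.
  by move: dtt; rewrite -t0 (diagonal0 _ dd) ltxx.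
have t1 : t < 1.
  rewrite lt_neqAle It.2 andbT; apply/negP => /eqP t1.
  by move: dtt; rewrite t1 d1 ltxx.
have [dh ft] : derivable (fun s => delta s / 2) t 1 /\
    derive1 (fun s => delta s / 2) t = f t by apply: f'E; rewrite t0.
have [dH kt] := H'E t0.
have [ddt ->] := derive1_half_inv _ _ dh; split => //; rewrite ft.
suff : k t <= 0.
  by rewrite /k ge_min => /orP[]; have := f01 t; clear; [left|right]; lra.
suff : 0 <= derive1 (- H) t.
  by rewrite derive1E (deriveN dH) -derive1E kt oppr_ge0.
apply: derive1_ge0_near; first exact: derivableN dH.
near=> s; rewrite !fctE.
have s0 : 0 <= s by near: s; exact: lt_le_nbhsr.
have s1 : s <= 1 by near: s; exact: lt_le_nbhsl.
have Is : inI s by [].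
(* As [delta] grows at rate at most 2, staying within a third of the gap [t - delta t] keeps [delta]
   at the larger of [s], [t] below the smaller one, as [AB_incr] requires. *)
have st1 : s < t + (t - delta t) / 3 by near: s; apply: lt_nbhsl; lra.
have st2 : t - (t - delta t) / 3 < s by near: s; apply: lt_nbhsr; lra.
have [ts|/ltW st] := leP t s.
  have dts := dL _ _ It Is ts.
  have := AB_incr t s It Is ts.
  have -> : delta s < t by have := dts; have := st1; clear; lra.
  by move=> /(_ isT) ?; apply: mulr_ge0; rewrite subr_ge0 ?lerN2.
have := AB_incr s t Is It st.
have -> : delta t < s by have := st2; have := dtt; clear; lra.
by move=> /(_ isT) ?; apply: mulr_le0; rewrite subr_le0 ?lerN2.
Unshelve. all: by end_near. Qed.

Theorem theorem3p8 (R : realType) (delta : R -> R) :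
  is_diagonal delta ->
  ((forall x y : R, inI x -> inI y -> Cbar delta x y = Kdelta delta x y) <->
   (lebesgue_measure : set R -> \bar R).-negligible
     [set x | Lambda delta x /\
              ~ (derivable delta x 1 /\
                 (derive1 delta x = 0 \/ derive1 delta x = 2))]).
Proof.
move=> dd; split=> [CK|[N [mN N0 sN]] x y Ix Iy].
  have [N [mN N0 sN]] := diagonal_derive_ae _ dd CK.
  exists N; split => //; apply: subset_trans sN => t /= [Lt nd] H.
  exact: nd (H Lt).
have [Kcop _] := half_split_sym_copula _ dd.
(* The half splitting has diagonal [delta] and attains the bound of [copula_le_K], so it also
   realizes the supremum over all copulas. *)
rewrite KdeltaE//; apply: sup_attained.
  by exists (split_copula (fun t => delta t / 2) (fun t => delta t / 2)) => //;
    rewrite /split_copula mulrDl.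
move=> _ [C Cd <-]; apply: copula_le_K => //.
by exists N; split => //; apply: subset_trans sN => t /= /not_implyP.
Qed.
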